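(* Let $(\Omega,\Sigma,\mu)$ be a measure space with $\mu(\Omega)=\infty$. Let $\{f_n\}_{n=1}^\infty$ be a sequence of real-valued measurable functions on $\Omega$ and let $f$ be a real-valued measurable function on $\Omega$ such that $f_n\to f$ almost everywhere. Then $f_n\to f$ almost uniformly if and only if for every $\lambda>0$ there exists $n_\lambda\in\mathbb{N}$ such that $$\mu\Big(\Big\{\omega\in\Omega:\ \sup_{n\ge n_\lambda}|f_n(\omega)-f(\omega)|\ge\lambda\Big\}\Big)<\infty.$$
   Context: For a real-valued measurable function $g$ on $\Omega$, $\|g\|_\infty=\operatorname{ess\,sup}_{\omega\in\Omega}|g(\omega)|$, regarded as an element of $[0,\infty]$ (so $\|g_n\|_\infty\to 0$ means that $\|g_n\|_\infty$ is finite for all sufficiently large $n$ and tends to $0$; finitely many terms may be infinite). $\chi_E$ denotes the characteristic function of $E\in\Sigma$. Pointwise suprema are taken in $[0,\infty]$. Almost everywhere convergence: $f_n\to f$ almost everywhere if there exists $E\in\Sigma$ with $\mu(\Omega\setminus E)=0$ and $f_n(\omega)\to f(\omega)$ for all $\omega\in E$. Almost uniform convergence: $f_n\to f$ almost uniformly if for every $\varepsilon>0$ there exists $E\in\Sigma$ such that $\mu(\Omega\setminus E)<\varepsilon$ and $\|(f_n-f)\chi_E\|_\infty\to 0$ as $n\to\infty$. *)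

(* Defs.v *)
From HB Require Import structures.
From mathcomp Require Import all_boot all_order all_algebra.
From mathcomp Require Import all_classical all_reals all_analysis.

Set Implicit Arguments.
Unset Strict Implicit.
Unset Printing Implicit Defensive.

Import Order.TTheory GRing.Theory Num.Theory.
Import numFieldNormedType.Exports.

Local Open Scope classical_set_scope.
Local Open Scope ring_scope.

Definition ae_cvg (d : measure_display) (T : measurableType d) (R : realType)
    (mu : {measure set T -> \bar R}) (f_ : nat -> T -> R) (f : T -> R) : Prop :=
  exists E : set T, [/\ measurable E, mu (~` E) = 0%E &
    forall w, E w -> f_ n w @[n --> \oo] --> f w].

(* The norm is the library's L^oo norm, with values in \bar R: it is the
   essential supremum of the absolute value (and 0 when mu setT = 0).
   Convergence to 0 is in \bar R, so finitely many norms may be +oo. *)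
Definition almost_uniform_cvg (d : measure_display) (T : measurableType d)
    (R : realType) (mu : {measure set T -> \bar R})
    (f_ : nat -> T -> R) (f : T -> R) : Prop :=
  forall eps : R, 0 < eps ->
  exists E : set T, [/\ measurable E, (mu (~` E) < eps%:E)%E &
    ('N[mu]_+oo[EFin \o ((f_ n \- f) \* \1_E)%R])%E @[n --> \oo] --> 0%E].

(* Main.v *)
Require Import Defs.
From HB Require Import structures.
From mathcomp Require Import all_boot all_order all_algebra.
From mathcomp Require Import all_classical all_reals all_analysis.
From mathcomp Require Import measurable_realfun ess_sup_inf.
Import Order.TTheory GRing.Theory Num.Theory.
Import numFieldNormedType.Exports.
Local Open Scope classical_set_scope.
Local Open Scope ring_scope.

Set Implicit Arguments.
Unset Strict Implicit.

(** Write [S(l, n)] for the set where [sup_(k >= n) |f_k - f| >= l]. If the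
    norms on [E] are eventually below [l / 2], then [S(l, N)] is contained in
    [~` E] up to a null set, so it has finite measure. Conversely, [S(l, n)]
    decreases with [n] to a null set by a.e. convergence, and a finite value of
    [mu (S(l, n))] gives continuity from above, so [mu (S(l, n))] tends to 0.
    As in Egorov's theorem, one removes the union of the sets [S(1/(k+1), n_k)]
    with [n_k] chosen to make their measures summable below [eps]. *)

(** Used for norms and for measures alike: the bound with [e = 1] makes the terms eventually finite,
    and real convergence applies to [fine]. *)
Lemma ge0_cvge0P (R : realType) (u : nat -> \bar R) :
  (forall n, 0 <= u n)%E ->
  (u n @[n --> \oo] --> 0%E) <->
  (forall e : R, 0 < e -> \forall n \near \oo, (u n <= e%:E)%E).
Proof.
move=> u0; split=> [u_cvg e e0|ule].
  have ult : \forall n \near \oo, (u n < e%:E)%E.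
    exact: (u_cvg _ (nbhs_open_ereal_lt (r := 0) (f := fun=> e) e0)).
  by apply: filterS ult => n /ltW.
apply/fine_cvgP; split.
  apply: filterS (ule 1 ltr01) => n un1.
  by rewrite ge0_fin_numE// (le_lt_trans un1)// ltry.
apply/cvgr0Pnorm_le => e e0; apply: filterS (ule e e0) => n une /=.
rewrite ger0_norm ?fine_ge0// -lee_fin fineK//.
by rewrite ge0_fin_numE// (le_lt_trans une)// ltry.
Qed.

(** Positive total mass selects the branch of the norm that is an essential supremum. *)
Lemma Lnormy_leP (d : measure_display) (T : measurableType d) (R : realType)
    (mu : {measure set T -> \bar R}) (g : T -> \bar R) (e : \bar R) :
  (0 < mu [set: T])%E ->
  ('N[mu]_+oo[g] <= e)%E <-> (\forall w \ae mu, `|g w| <= e)%E.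
Proof. by move=> muT; rewrite unlock muT; split=> /ess_supP. Qed.

Section tail_deviation.
Context (d : measure_display) (T : measurableType d) (R : realType).
Variables (mu : {measure set T -> \bar R}) (f_ : nat -> T -> R) (f : T -> R).

Definition tail_deviation (l : R) (n : nat) : set T :=
  [set w | (l%:E <=
    ereal_sup [set `|f_ k w - f w|%:E | k in [set k | (n <= k)%N]])%E].

Lemma nonincreasing_tail_deviation (l : R) :
  nonincreasing_seq (tail_deviation l).
Proof.
move=> m n mn; apply/subsetPset => w /= /le_trans; apply.
by apply: ereal_sup_le => _ [k /= nk <-]; exists k => //=; apply: leq_trans nk.
Qed.

Lemma tail_deviationNP (l : R) (n k : nat) (w : T) :
  ~ tail_deviation l n w -> (n <= k)%N -> `|f_ k w - f w| < l.
Proof.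
move=> /negP; rewrite -ltNge => supl nk; rewrite -lte_fin.
by apply: le_lt_trans supl; apply: ereal_sup_ubound; exists k.
Qed.

(** The gap between [e] and [l] matters: deviations that are all below [l] may still have supremum
    [l]. *)
Lemma tail_deviation_bounded (l e : R) (n : nat) (w : T) : e < l ->
  (forall k, (n <= k)%N -> `|f_ k w - f w| <= e) -> ~ tail_deviation l n w.
Proof.
move=> el fe; apply/negP; rewrite -ltNge (@le_lt_trans _ _ e%:E) ?lte_fin//.
by apply: ge_ereal_sup => _ [k /= nk <-]; rewrite lee_fin fe.
Qed.

Hypothesis mf_ : forall n : nat, measurable_fun [set: T] (f_ n).
Hypothesis mf : measurable_fun [set: T] f.

Lemma measurable_tail_deviation (l : R) (n : nat) :
  measurable (tail_deviation l n).
Proof.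
rewrite -[tail_deviation l n]setTI.
(* The tail supremum is [esups] at [n], so the set is a superlevel set of a measurable function. *)
apply: (emeasurable_fun_c_infty (f := fun w =>
  esups (fun k => `|f_ k w - f w|%:E) n)) => //.
apply: measurable_fun_esups => k; apply/measurable_EFinP.
by apply: measurableT_comp => //; apply: measurable_funB.
Qed.

Lemma cvg_mu_tail_deviation (l : R) (n0 : nat) : 0 < l -> ae_cvg mu f_ f ->
  (mu (tail_deviation l n0) < +oo)%E ->
  mu (tail_deviation l n) @[n --> \oo] --> 0%E.
Proof.
move=> l0 [E [mE muE0 f_f]] fin.
have mS := measurable_tail_deviation.
(* Indices are shifted by [n0] because continuity from above needs a first set of finite measure. *)
have mI : measurable (\bigcap_n tail_deviation l (n + n0)).
  exact: bigcap_measurable.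
have <- : mu (\bigcap_n tail_deviation l (n + n0)) = 0%E.
  apply: (@subset_measure0 _ _ _ _ _ (~` E)) => //; first exact: measurableC.
  move=> w Sw Ew; have /cvgrPdist_le/(_ (l / 2)) := f_f _ Ew.
  move=> /(_ (divr_gt0 l0 (ltr0Sn _ _)))[N _ fN].
  apply: (tail_deviation_bounded (e := l / 2)) (Sw N I).
    by rewrite ltr_pdivrMr// ltr_pMr// ltr1n.
  move=> k Nk; rewrite distrC; apply: fN => /=.
  by apply: leq_trans Nk; rewrite leq_addr.
rewrite -(cvg_shiftn n0); apply: nonincreasing_cvg_mu => //.
by move=> m n mn; apply: nonincreasing_tail_deviation; rewrite leq_add2r.
Qed.

Lemma almost_uniform_cvg_tail_deviation (l : R) :
  (0 < mu [set: T])%E -> almost_uniform_cvg mu f_ f -> 0 < l ->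
  exists n, (mu (tail_deviation l n) < +oo)%E.
Proof.
move=> muT au l0; have [E [mE muE]] := au 1 ltr01.
have l20 : 0 < l / 2 by rewrite divr_gt0.
move/ge0_cvge0P => /(_ (fun=> Lnorm_ge0 _ _ _) _ l20)[N _ leN].
exists N.
(* Each index has its own exceptional null set; as there are countably many, one null set [A] covers
   them all. *)
have /ae_foralln[A [mA muA0 sA]] (n : nat) : \forall w \ae mu,
    (`|((f_ (n + N) \- f) \* \1_E) w| <= l / 2)%R.
  have := leN (n + N)%N; rewrite /= leq_addl => /(_ isT).
  by move/(Lnormy_leP _ _ muT); apply: filterS => w /=; rewrite lee_fin.
have mS := measurable_tail_deviation l N.
apply: (@le_lt_trans _ _ (mu (~` E `|` A))).
  rewrite le_measure ?inE//; first by apply: measurableU => //; exact: measurableC.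
  move=> w Sw; have [Ew|] := pselect (E w); last by left.
  right; apply: sA => /= leA; apply: (tail_deviation_bounded (e := l / 2)) Sw.
    by rewrite ltr_pdivrMr// ltr_pMr// ltr1n.
  move=> k Nk; have := leA (k - N)%N.
  by rewrite subnK//= indicE mem_set// mulr1.
rewrite measureU0//; last exact: measurableC.
by rewrite (lt_trans muE)// ltry.
Qed.

Lemma tail_deviation_almost_uniform_cvg :
  (0 < mu [set: T])%E -> ae_cvg mu f_ f ->
  (forall l : R, 0 < l -> exists n, (mu (tail_deviation l n) < +oo)%E) ->
  almost_uniform_cvg mu f_ f.
Proof.
move=> muT f_f fin eps eps0.
have eps2 : 0 < eps / 2 by rewrite divr_gt0.
(* These bounds sum to [eps / 2]; the halving leaves room for the strict inequality with [eps]. *)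
have /choice[n_ n_small] (k : nat) : exists n,
    (mu (tail_deviation k.+1%:R^-1 n) <= (eps / 2 / (2 ^ k.+1)%:R)%:E)%E.
  have k0 : (0 : R) < k.+1%:R^-1 by rewrite invr_gt0 ltr0n.
  have [n0 /(cvg_mu_tail_deviation k0 f_f)] := fin _ k0.
  have ek0 : 0 < eps / 2 / (2 ^ k.+1)%:R by rewrite divr_gt0// ltr0n expn_gt0.
  move/ge0_cvge0P => /(_ (fun=> measure_ge0 _ _) _ ek0)[N _ /(_ N (leqnn N))].
  by exists N.
have mS := measurable_tail_deviation.
have mU : measurable (\bigcup_k tail_deviation k.+1%:R^-1 (n_ k)).
  exact: bigcup_measurable.
exists (~` \bigcup_k tail_deviation k.+1%:R^-1 (n_ k)); split.
- exact: measurableC.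
- rewrite setCK (@le_lt_trans _ _ (eps / 2)%:E)//; last first.
    by rewrite lte_fin ltr_pdivrMr// ltr_pMr// ltr1n.
  apply: le_trans (epsilon_trick0 xpredT (ltW eps2)).
  apply: le_trans (lee_nneseries (v := fun k => _%:E) _ (fun k _ => n_small k)).
    exact: measure_sigma_subadditive.
  by move=> k _ _; exact: measure_ge0.
- apply/ge0_cvge0P => [n|e e0]; first exact: Lnorm_ge0.
  (* With [1/(k+1) < e], every point outside the [k]-th removed set has all deviations from [n_ k]
     on below [e]; the bound holds everywhere, not just almost everywhere. *)
  have [k _ /(_ k (leqnn k)) /= ke] := near_infty_natSinv_lt (PosNum e0).
  exists (n_ k) => // n /= nk; apply/(Lnormy_leP _ _ muT); apply: nearW => w /=.
  rewrite lee_fin indicE; have [Sw|_] := boolP (w \in _); last first.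
    by rewrite mulr0 normr0 ltW.
  rewrite mulr1 ltW// (lt_trans _ ke)// (tail_deviationNP (n := n_ k))// => Skw.
  by apply: (set_mem Sw); exists k.
Qed.

End tail_deviation.

Theorem theorem1p2 (d : measure_display) (T : measurableType d) (R : realType)
    (mu : {measure set T -> \bar R}) (f_ : nat -> T -> R) (f : T -> R)
    (mu_infinite : mu [set: T] = +oo%E)
    (mf_ : forall n : nat, measurable_fun [set: T] (f_ n))
    (mf : measurable_fun [set: T] f)
    (f_f : ae_cvg mu f_ f) :
  almost_uniform_cvg mu f_ f <->
  (forall lambda : R, 0 < lambda -> exists n_lambda : nat,
    (mu [set w | lambda%:E <=
           ereal_sup [set `|f_ n w - f w|%:E | n in [set n | (n_lambda <= n)%N]]]
     < +oo)%E).
Proof.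
have muT : (0 < mu [set: T])%E by rewrite mu_infinite ltry.
split=> [au lambda lambda0|fin].
  exact: almost_uniform_cvg_tail_deviation.
exact: tail_deviation_almost_uniform_cvg.
Qed.
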